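(* Suppose that $\varphi(x)=\sum_{k=0}^\infty\frac{\gamma_k}{k!}x^k\in\mathscr{L}\text{-}\mathscr{P}^+$. Then for every $t\in[0,1]$ the sequence $\{B_k^{\varphi}(t)\}_{k=0}^\infty$ is a multiplier sequence, where $$B_k^{\varphi}(t)=\sum_{j=0}^k\binom kj(1-t)^j\gamma_{k-j}t^{k-j}.$$
   Context: Convention: $0^0=1$. A real entire function $\varphi(x)=\sum_{k=0}^\infty \frac{\gamma_k}{k!}x^k$ is said to be of type I in the Laguerre–Pólya class if $\varphi(x)$ or $\varphi(-x)$ can be written as $c x^m e^{\sigma x}\prod_{k=1}^{\omega}\left(1+\frac{x}{x_k}\right)$, where $c\in\mathbb{R}$, $m$ is a non-negative integer, $\sigma\ge 0$, $x_k>0$, $0\le\omega\le\infty$ and $\sum_{k=1}^{\omega}\frac1{x_k}<+\infty$. If in addition $\gamma_k\ge 0$ for all $k=0,1,2,\ldots$, we write $\varphi\in\mathscr{L}\text{-}\mathscr{P}^+$. A sequence of real numbers $\{\gamma_k\}_{k=0}^\infty$ is a multiplier sequence if the linear operator $T$ on real polynomials defined by $T[x^k]=\gamma_kx^k$, $k=0,1,2,\ldots$, has the property that $T[p]$ has no non-real zeros whenever the real polynomial $p$ has no non-real zeros (the zero polynomial is regarded as having no non-real zeros). *)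

(* Defs.v *)
From HB Require Import structures.
From mathcomp Require Import all_boot all_order all_algebra.
From mathcomp Require Import all_classical all_reals all_analysis.
From mathcomp Require Import complex.

Set Implicit Arguments.
Unset Strict Implicit.
Unset Printing Implicit Defensive.

Import Order.TTheory GRing.Theory Num.Theory.
Import numFieldNormedType.Exports.

Local Open Scope classical_set_scope.
Local Open Scope complex_scope.
Local Open Scope ring_scope.

(* Stated over an abstract numFieldType because the norm topology is attached
   to these; it is used below at K = R[i]. *)
Definition seq_cvg (K : numFieldType) (u : nat -> K) (l : K) : Prop :=
  u @ \oo --> l.

Definition cexp (R : realType) (z : R[i]) : R[i] :=
  (expR (complex.Re z))%:C * (cos (complex.Im z) +i* sin (complex.Im z)).

(* phi is the real entire function with Taylor coefficients gamma k / k!. *)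
Definition real_entire (R : realType) (gamma : nat -> R) (phi : R[i] -> R[i]) :
    Prop :=
  forall z : R[i],
    seq_cvg (fun n => \sum_(k < n) (gamma k / (k`!)%:R)%:C * z ^+ k) (phi z).

(* The number omega of factors is a natural number (Some N) or infinite (None);
   factors are numbered from 0. *)
Definition below (omega : option nat) (k : nat) : bool :=
  if omega is Some N then (k < N)%N else true.

Definition has_type_I_product (R : realType) (phi : R[i] -> R[i]) : Prop :=
  exists (c : R) (m : nat) (sigma : R) (omega : option nat) (x : nat -> R),
    [/\ 0 <= sigma,
        forall k, below omega k -> 0 < x k,
        cvgn (series (fun k => if below omega k then (x k)^-1 else 0)) &
        forall z : R[i],
          exists2 P : R[i],
            seq_cvg (fun n => \prod_(k < n | below omega k) (1 + z / (x k)%:C)) P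
            & phi z = c%:C * z ^+ m * cexp (sigma%:C * z) * P].

Definition laguerre_polya_I (R : realType) (gamma : nat -> R)
    (phi : R[i] -> R[i]) : Prop :=
  real_entire gamma phi /\
  (has_type_I_product phi \/ has_type_I_product (fun z => phi (- z))).

Definition laguerre_polya_plus (R : realType) (gamma : nat -> R)
    (phi : R[i] -> R[i]) : Prop :=
  laguerre_polya_I gamma phi /\ forall k, 0 <= gamma k.

Definition no_nonreal_zeros (R : realType) (p : {poly R}) : Prop :=
  p = 0 \/
  forall z : R[i], root (map_poly (real_complex R) p) z -> complex.Im z = 0.

Definition diag_op (R : realType) (gamma : nat -> R) (p : {poly R}) : {poly R} :=
  \poly_(k < size p) (gamma k * p`_k).

Definition multiplier_sequence (R : realType) (gamma : nat -> R) : Prop :=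
  forall p : {poly R}, no_nonreal_zeros p -> no_nonreal_zeros (diag_op gamma p).

(* x ^+ 0 = 1 for every x, in particular 0 ^+ 0 = 1. *)
Definition bernstein_seq (R : realType) (gamma : nat -> R) (t : R) (k : nat) : R :=
  \sum_(j < k.+1) 'C(k, j)%:R * (1 - t) ^+ j * gamma (k - j)%N * t ^+ (k - j).

(* Main.v *)
Require Import Defs.
From mathcomp Require Import all_boot all_order all_algebra.
From mathcomp Require Import all_classical all_reals all_analysis.
From mathcomp Require Import complex zify ring lra.

Import Order.TTheory GRing.Theory Num.Theory.
Import numFieldNormedType.Exports.

Local Open Scope complex_scope.
Local Open Scope ring_scope.

(** The exponential generating function of [bernstein_seq gamma t] is
    exp((1 - t) x) phi(t x), again an entire function of type I with nonnegative
    coefficients when 0 <= t <= 1.  So the result is the easy half of the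
    Polya-Schur theorem, for this function.

    A polynomial F = c prod_i (1 + a_i X) with all a_i >= 0 gives the multiplier
    sequence k! F_k, for the following reason.  The value at x of the image of p
    is F(x D) p (0) = c (prod_i (1 + a_i x D)) p (0), where D is the derivation
    ([iter_deriv_at0]).  Fix x in the open upper half-plane.  Each operator
    1 + a x D maps polynomials without zeros in the open upper half-plane to
    polynomials of the same kind, because q'/q has nonpositive imaginary part
    there while -1/(a x) has positive imaginary part.  The same argument on the
    real line shows that no real zero is created ([stable_step]).  Hence if p is
    real-rooted, p(0) <> 0 and c <> 0, the image of p does not vanish at x
    ([diag_op_real_rooted_nonroot0]); a zero of p at 0 is moved away
    and brought back by a limit ([diag_op_real_rootedMXn]).

    Multiplier sequences are closed under pointwise limits
    ([multiplier_sequence_cvg]), because so are real-rooted polynomials of bounded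
    degree.  In place of Hurwitz's theorem this uses an inequality that passes to
    the limit: |q(s)|^2 <= K^d |q(z)|^2 for q real-rooted of degree less than d, s
    real and z not real, with K depending only on s and z ([real_rooted_bound]).
    If the limit vanishes at z, it then vanishes at every real s.

    It remains to write B_k / k! as the limit of the k-th coefficients of such
    polynomials.  Truncating the product, and replacing x^m by (x + 1/n)^m and
    exp(sigma x) by (1 + sigma x / n)^n, gives polynomials that converge to phi
    pointwise on the positive half-line; as their coefficients have constant sign,
    the coefficients converge too ([coef_cvg], [type_I_lp_limit]).  The same
    lemma treats exp((1 - t) x), and the Cauchy product gives B_k / k!
    ([multiplier_bernstein]).  Finally, if the product formula is given for phi(-x),
    then the inequality |phi(-x)| <= phi(x) for x >= 0 forces phi to be
    zero or a monomial, which is also of the direct form ([type_I_reflect]). *)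

Set Implicit Arguments.
Unset Strict Implicit.
Unset Printing Implicit Defensive.

(** * Differential operators preserving zero-free half-planes *)

Section HalfPlane.
Variable R : realType.
Implicit Types (p q : {poly R[i]}) (w x : R[i]).
Local Notation Re := complex.Re.
Local Notation Im := complex.Im.

Definition stable p : Prop := forall w, 0 < Im w -> p.[w] != 0.

(** The expression bounded here is the imaginary part of q' times the conjugate
    of q; it has the sign of Im (q'/q), and q'/q is the sum of the 1 / (w - r),
    each with nonpositive imaginary part because w lies above r.  Clearing
    denominators avoids excluding the zeros of q. *)
Lemma Im_deriv_prod (rs : seq R[i]) w :
    (forall r, r \in rs -> Im r <= 0) -> 0 <= Im w ->
  let q := \prod_(r <- rs) ('X - r%:P) in
  Im (q^`()).[w] * Re q.[w] - Re (q^`()).[w] * Im q.[w] <= 0.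
Proof.
move=> Hrs Hw /=; elim: rs Hrs => [|r rs IH] Hrs.
  by rewrite big_nil derivC horner0 /= !mul0r subr0.
rewrite big_cons derivM derivXsubC mul1r hornerD !hornerM hornerXsubC.
have {IH} := IH (fun s hs => Hrs s (@mem_behead _ (r :: rs) s hs)).
have := Hrs r (mem_head _ _).
set h := \prod_(_ <- rs) _; case: (h.[w]) => h1 h2; case: (h^`().[w]) => k1 k2.
case: w Hw => w1 w2 /= Hw; case: r {Hrs} => r1 r2 /= Hr IH.
rewrite -(subr_ge0 _ 0) sub0r.
set u1 := w1 - r1; set u2 := w2 - r2.
have -> : - ((h2 + (u1 * k2 + u2 * k1)) * (u1 * h1 - u2 * h2) -
             (h1 + (u1 * k1 - u2 * k2)) * (u1 * h2 + u2 * h1)) =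
  u2 * (h1 ^+ 2 + h2 ^+ 2) + (u1 ^+ 2 + u2 ^+ 2) * - (k2 * h1 - k1 * h2) by ring.
apply: addr_ge0; apply: mulr_ge0; rewrite ?addr_ge0 ?sqr_ge0 ?oppr_ge0 //.
Qed.

Lemma stable_Im_deriv p w : stable p -> 0 <= Im w ->
  Im (p^`()).[w] * Re p.[w] - Re (p^`()).[w] * Im p.[w] <= 0.
Proof.
move=> Sp Hw; have [rs Ep] := closed_field_poly_normal p.
have Hrs r : r \in rs -> Im r <= 0.
  move=> Hr; rewrite leNgt; apply/negP => /Sp /eqP; apply.
  apply/eqP; rewrite -/(root p r) Ep; have [->|lc0] := eqVneq (lead_coef p) 0.
    by rewrite scale0r root0.
  by rewrite rootZ // root_prod_XsubC.
have := Im_deriv_prod Hrs Hw; rewrite {1 2 3 4}Ep derivZ !hornerZ /=.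
set q := \prod_(_ <- _) _; case: (q.[w]) => a b; case: (q^`().[w]) => c d /=.
case: (lead_coef p) => l1 l2 /= H.
have -> : (l1 * d + l2 * c) * (l1 * a - l2 * b) -
          (l1 * c - l2 * d) * (l1 * b + l2 * a) =
          (l1 ^+ 2 + l2 ^+ 2) * (d * a - c * b) by ring.
by rewrite mulr_ge0_le0 // addr_ge0 // sqr_ge0.
Qed.

(** If p + a x p' = 0 at w with a > 0, then p' times the conjugate of p is
    -|p|^2 / (a x), whose imaginary part is positive unless p(w) = 0.  Allowing w
    to be real is what keeps track of the value at 0. *)
Lemma stable_step p (a : R) x w : 0 <= a -> 0 < Im x -> stable p ->
  0 <= Im w -> p.[w] != 0 -> (p + (a%:C * x) *: p^`()).[w] != 0.
Proof.
move=> a0 x0 Sp Hw; apply: contra => /eqP.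
have := stable_Im_deriv Sp Hw; rewrite hornerD hornerZ.
case: (p.[w]) => q1 q2; case: (p^`().[w]) => d1 d2.
case: x x0 => x1 x2 /= x0 H [].
rewrite !mul0r subr0 addr0 => E1 E2.
have Q1 : q1 = - (a * (x1 * d1 - x2 * d2)) by lra.
have Q2 : q2 = - (a * (x1 * d2 + x2 * d1)) by lra.
move: H; rewrite Q1 Q2.
have -> : d2 * - (a * (x1 * d1 - x2 * d2)) - d1 * - (a * (x1 * d2 + x2 * d1)) =
          x2 * (a * (d1 ^+ 2 + d2 ^+ 2)) by ring.
rewrite pmulr_rle0 // => H.
have /eqP : a * (d1 ^+ 2 + d2 ^+ 2) = 0.
  by apply/eqP; rewrite eq_le H mulr_ge0 // addr_ge0 // sqr_ge0.
rewrite mulf_eq0 => /orP[/eqP->|]; first by rewrite !mul0r oppr0 eqxx.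
by rewrite paddr_eq0 ?sqr_ge0 // !sqrf_eq0 => /andP[/eqP-> /eqP->];
   rewrite !mulr0 subrr addr0 mulr0 oppr0 eqxx.
Qed.

Lemma stable_iter (s : seq R) p x : all (>= 0) s -> 0 < Im x -> stable p ->
    p.[0] != 0 ->
  (foldr (fun a q => q + (a%:C * x) *: q^`()) p s).[0] != 0.
Proof.
move=> s0 x0 Sp p0; set L := foldr _ _.
suff [] : stable (L s) /\ (L s).[0] != 0 by [].
elim: s s0 => //= a s IH /andP[a0 /IH [S1 N1]]; split; last exact: stable_step.
by move=> w Hw; apply: stable_step => //; [exact: ltW | exact: S1].
Qed.

End HalfPlane.

(** * Limits of real-rooted polynomials and of multiplier sequences *)

Section RealRooted.
Variable R : realType.
Implicit Types (p q : {poly R}) (z w : R[i]).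
Local Notation Re := complex.Re.
Local Notation Im := complex.Im.
Local Notation toC := (map_poly (real_complex R)).

(** Conjugation exchanges the two half-planes, so for real polynomials the upper
    one suffices. *)
Lemma no_nonreal_zerosP p :
  no_nonreal_zeros p <-> p = 0 \/ stable (toC p).
Proof.
split=> -[->|H]; try by left.
  by right=> w w0; apply/negP => /eqP /eqP /H Iw; rewrite Iw ltxx in w0.
right=> z Hz; case: (ltgtP (Im z) 0) => // Iz; last first.
  by have := H z Iz; rewrite -rootE Hz.
have := H (z^*)%C; rewrite -rootE; have -> : Im (z^*)%C = - Im z by case: (z).
rewrite oppr_gt0 => /(_ Iz) /negP []; rewrite rootE.
have := complex_root_conj (toC p) z; rewrite -map_poly_comp.
rewrite (eq_map_poly (g := real_complex R)); last by move=> c; exact: conjc_real.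
by rewrite Hz -rootE.
Qed.

Definition normsq z : R := Re z ^+ 2 + Im z ^+ 2.

Lemma normsqM z w : normsq (z * w) = normsq z * normsq w.
Proof. by case: z w => [a b] [c d]; rewrite /normsq /=; ring. Qed.

Lemma normsq_ge0 z : 0 <= normsq z.
Proof. by rewrite addr_ge0 // sqr_ge0. Qed.

Lemma normsq_prod (I : Type) (s : seq I) (F : I -> R[i]) :
  normsq (\prod_(i <- s) F i) = \prod_(i <- s) normsq (F i).
Proof.
elim: s => [|i s IH]; last by rewrite !big_cons normsqM IH.
by rewrite !big_nil /normsq /= expr1n expr0n addr0.
Qed.

(** Over the factors of q this is (s - r)^2 <= K |z - r|^2 for real r, a
    consequence of (A + B)^2 <= 2 A^2 + 2 B^2 with A = Re z - r and
    B = s - Re z, and of |z - r| >= |Im z|. *)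
Lemma real_rooted_bound d q (s : R) z :
    (size q <= d)%N -> no_nonreal_zeros q -> 0 < Im z ->
  q.[s] ^+ 2 <=
  (2 + 2 * (s - Re z) ^+ 2 / Im z ^+ 2) ^+ d * normsq (toC q).[z].
Proof.
move=> sq Hq z0; set K := 2 + _.
have K1 : 1 <= K.
  have : 0 <= 2 * (s - Re z) ^+ 2 / Im z ^+ 2.
    apply: divr_ge0 (sqr_ge0 _); apply: mulr_ge0 (sqr_ge0 _); exact: ler0n.
  rewrite /K; lra.
have K0 : 0 <= K by apply: le_trans K1.
case: Hq => [->|Hq].
  by rewrite rmorph0 !horner0 expr0n /= mulr_ge0 ?exprn_ge0 ?normsq_ge0.
have [->|q0] := eqVneq q 0.
  by rewrite rmorph0 !horner0 expr0n /= mulr_ge0 ?exprn_ge0 ?normsq_ge0.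
have -> : q.[s] ^+ 2 = normsq (toC q).[s%:C].
  by rewrite horner_map /normsq /= expr0n addr0.
have [rs Ep] := closed_field_poly_normal (toC q).
have lc0 : lead_coef (toC q) != 0 by rewrite lead_coef_eq0 map_poly_eq0.
have Hrs r : r \in rs -> Im r = 0.
  by move=> Hr; apply: Hq; rewrite Ep rootZ // root_prod_XsubC.
have srs : (size rs <= d)%N.
  apply: ltnW; apply: leq_trans sq; rewrite -(size_map_poly (real_complex R)).
  by rewrite Ep size_scale // size_prod_XsubC.
rewrite Ep !hornerZ !horner_prod !normsqM !normsq_prod mulrCA.
apply: ler_wpM2l; first exact: normsq_ge0.
apply: (@le_trans _ _ (K ^+ size rs * \prod_(i <- rs) normsq ('X - i%:P).[z])).
  elim: rs Hrs {srs Ep} => [|r rs IH] Hrs; first by rewrite !big_nil mulr1.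
  rewrite !big_cons /= exprS mulrACA.
  apply: ler_pM; rewrite ?normsq_ge0 //.
  - by apply: prodr_ge0 => i _; exact: normsq_ge0.
  - rewrite !hornerXsubC; have := Hrs r (mem_head _ _).
    case: r {Hrs} => r1 r2 /= ->; rewrite /K; case: z z0 {K K1 K0 IH} => z1 z2 /= z0.
    rewrite /normsq /= oppr0 !addr0 expr0n addr0.
    have -> : s - r1 = (z1 - r1) + (s - z1) by ring.
    set A := z1 - r1; set B := s - z1.
    have -> : (2 + 2 * B ^+ 2 / z2 ^+ 2) * (A ^+ 2 + z2 ^+ 2) =
      2 * A ^+ 2 + 2 * B ^+ 2 + 2 * z2 ^+ 2 + 2 * (A * B / z2) ^+ 2.
      by field; rewrite gt_eqF.
    have := sqr_ge0 (A - B); have := sqr_ge0 z2; have := sqr_ge0 (A * B / z2).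
    nra.
  - by apply: IH => t ht; apply: Hrs; rewrite inE ht orbT.
apply: ler_wpM2r; last exact: ler_weXn2l.
by apply: prodr_ge0 => i _; exact: normsq_ge0.
Qed.

Lemma Re_sum (I : Type) (s : seq I) (F : I -> R[i]) :
  Re (\sum_(i <- s) F i) = \sum_(i <- s) Re (F i).
Proof. by apply: (big_morph (@complex.Re R)) => // -[a b] [c e]. Qed.

Lemma Im_sum (I : Type) (s : seq I) (F : I -> R[i]) :
  Im (\sum_(i <- s) F i) = \sum_(i <- s) Im (F i).
Proof. by apply: (big_morph (@complex.Im R)) => // -[a b] [c e]. Qed.

Lemma cvg_exprn (u : nat -> R) (l : R) n :
  (u @ \oo --> l)%classic -> ((fun k => u k ^+ n) @ \oo --> l ^+ n)%classic.
Proof. by move=> ul; exact: (continuous_cvg _ (@exprn_continuous R n l) ul). Qed.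

Lemma cvg_sum_seq (I : Type) (s : seq I) (P : pred I) (F : I -> nat -> R) (l : I -> R) :
  (forall i, P i -> (F i @ \oo --> l i)%classic) ->
  ((fun n => \sum_(i <- s | P i) F i n) @ \oo --> \sum_(i <- s | P i) l i)%classic.
Proof. by move=> H; apply: cvg_big => //; exact: add_continuous. Qed.

(** Both sides of [real_rooted_bound] are continuous in the coefficients, so the
    bound survives in the limit; a nonreal zero of the limit then makes every
    real number a zero. *)
Lemma no_nonreal_zeros_cvg d (u : nat -> {poly R}) q :
    (forall n, (size (u n) <= d)%N) -> (size q <= d)%N ->
    (forall n, no_nonreal_zeros (u n)) ->
    (forall k, ((fun n => (u n)`_k) @ \oo --> q`_k)%classic) ->
  no_nonreal_zeros q.
Proof.
move=> su sq Hu cu; apply/no_nonreal_zerosP.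
case: (pselect (q = 0)) => [|q0]; [by left|right => z z0].
apply/negP => /eqP qz; apply: q0.
have cvgS (c : nat -> R) : ((fun n => \sum_(k < d) (u n)`_k * c k) @ \oo -->
    \sum_(k < d) q`_k * c k)%classic.
  apply: cvg_sum_seq => k _; apply: cvgM; [exact: cu|exact: cvg_cst].
have HRe (p : {poly R}) : (size p <= d)%N ->
    Re (toC p).[z] = \sum_(k < d) p`_k * Re (z ^+ k).
  move=> sp; rewrite (@horner_coef_wide _ d) ?size_map_poly // Re_sum.
  apply: eq_bigr => k _; rewrite coef_map /=.
  by case: (z ^+ k) => a b /=; rewrite mul0r subr0.
have HIm (p : {poly R}) : (size p <= d)%N ->
    Im (toC p).[z] = \sum_(k < d) p`_k * Im (z ^+ k).
  move=> sp; rewrite (@horner_coef_wide _ d) ?size_map_poly // Im_sum.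
  apply: eq_bigr => k _; rewrite coef_map /=.
  by case: (z ^+ k) => a b /=; rewrite mul0r addr0.
have qs s : q.[s] = 0.
  apply/eqP; rewrite -sqrf_eq0 eq_le sqr_ge0 andbT.
  set K := (2 + 2 * (s - Re z) ^+ 2 / Im z ^+ 2) ^+ d.
  have -> : 0 = K * normsq (toC q).[z] by rewrite qz /normsq /= expr0n addr0 mulr0.
  apply: (@ler_cvg_to _ \oo%classic _ R
    (fun n => (u n).[s] ^+ 2) (fun n => K * normsq (toC (u n)).[z])).
  - apply: cvg_exprn; rewrite (horner_coef_wide _ sq).
    under eq_fun do rewrite (horner_coef_wide _ (su _)).
    exact: (cvgS (fun k => s ^+ k)).
  - apply: cvgM; first exact: cvg_cst.
    rewrite /normsq; apply: cvgD; apply: cvg_exprn; rewrite ?HRe ?HIm //.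
      by under eq_fun do rewrite (HRe _ (su _)); exact: (cvgS (fun k => Re (z ^+ k))).
    by under eq_fun do rewrite (HIm _ (su _)); exact: (cvgS (fun k => Im (z ^+ k))).
  - by apply: nearW => n; exact: real_rooted_bound.
apply/eqP; apply/negPn/negP => q0.
pose rs := [seq k%:R : R | k <- iota 0 (size q)].
have : (size rs < size q)%N.
  apply: max_poly_roots => //.
    by apply/allP => x _; apply/eqP; exact: qs.
  by rewrite map_inj_uniq ?iota_uniq // => i j /eqP; rewrite eqr_nat => /eqP.
by rewrite size_map size_iota ltnn.
Qed.

Lemma multiplier_sequence_cvg (g : nat -> nat -> R) (gamma : nat -> R) :
    (forall n, multiplier_sequence (g n)) ->
    (forall k, ((fun n => g n k) @ \oo --> gamma k)%classic) ->
  multiplier_sequence gamma.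
Proof.
move=> Hg cg p Hp.
apply: (@no_nonreal_zeros_cvg (size p) (fun n => diag_op (g n) p)) => [n||n|k].
- exact: size_poly.
- exact: size_poly.
- exact: Hg.
rewrite coef_poly; under eq_fun do rewrite coef_poly.
case: ifP => _; last exact: cvg_cst.
by apply: cvgM; [exact: cg|exact: cvg_cst].
Qed.

End RealRooted.

(** * Multiplier sequences of products of linear factors *)

Section PolynomialSymbol.
Variable R : realType.
Implicit Types (p q : {poly R}) (z w x : R[i]) (s : seq R).
Local Notation Re := complex.Re.
Local Notation Im := complex.Im.
Local Notation toC := (map_poly (real_complex R)).

Definition linear_prod s : {poly R} := \prod_(a <- s) (1 + a *: 'X).

(** The sequence whose exponential generating function is p. *)
Definition egf_coef p k : R := k`!%:R * p`_k.

Lemma coef_mul_linear p (a : R) k :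
  (p * (1 + a *: 'X))`_k = p`_k + a * (if k == 0%N then 0 else p`_k.-1).
Proof. by rewrite mulrDr mulr1 -scalerAr coefD coefZ coefMX. Qed.

(** This is the identity F(x D) q (0) = sum_k k! F_k x^k q_k.  A factor 1 + a X of
    F can be moved onto q, as q + a x q', because of k! (k + 1) = (k + 1)!. *)
Lemma iter_deriv_at0 s (q : {poly R[i]}) x n : (size q <= n)%N ->
  (foldr (fun a r => r + (a%:C * x) *: r^`()) q s).[0] =
  \sum_(k < n) (egf_coef (linear_prod s) k)%:C * x ^+ k * q`_k.
Proof.
elim/last_ind: s q => [|s a IH] q sq /=.
  rewrite horner_coef0 /linear_prod big_nil; case: n sq => [|n] sq.
    by rewrite big_ord0 nth_default.
  rewrite big_ord_recl big1 => [|k _].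
    by rewrite /egf_coef /= coef1 /= mulr1 rmorph1 !mul1r addr0.
  by rewrite /egf_coef coef1 /= mulr0 rmorph0 !mul0r.
rewrite foldr_rcons IH; last first.
  apply: leq_trans (size_polyD _ _) _; rewrite geq_max sq.
  apply: leq_trans (size_scale_leq _ _) _.
  by apply: leq_trans sq; apply: leq_trans (leq_pred _); exact: size_poly.
rewrite {IH} /linear_prod big_rcons /= -/(linear_prod s); set h := linear_prod s.
under eq_bigr do rewrite coefD coefZ coef_deriv mulrDr.
under [RHS]eq_bigr do rewrite /egf_coef coef_mul_linear mulrDr rmorphD 2!mulrDl.
rewrite !big_split /=; congr (_ + _).
have qn : q`_n = 0 by rewrite nth_default.
case: n sq qn => [|n] sq qn; first by rewrite !big_ord0.
rewrite big_ord_recr /= qn mul0rn !mulr0 addr0.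
rewrite [RHS]big_ord_recl /= !mulr0 rmorph0 !mul0r add0r.
apply: eq_bigr => k _; rewrite /egf_coef /bump /= add1n factS natrM exprS.
rewrite !rmorphM /= !rmorph_nat -mulr_natr; ring.
Qed.

Lemma coef_diag_op (g : nat -> R) p k : (diag_op g p)`_k = g k * p`_k.
Proof.
by rewrite coef_poly; case: ltnP => // h; rewrite nth_default // mulr0.
Qed.

Lemma diag_op_real_rooted_nonroot0 (c : R) s p : all (>= 0) s ->
    no_nonreal_zeros p -> p.[0] != 0 ->
  no_nonreal_zeros (diag_op (egf_coef (c *: linear_prod s)) p).
Proof.
move=> s0 /no_nonreal_zerosP[->|Sp] p0; first by rewrite horner0 eqxx in p0.
apply/no_nonreal_zerosP.
have [->|c0] := eqVneq c 0.
  left; apply/polyP => k.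
  by rewrite coef_diag_op /egf_coef scale0r coef0 mulr0 mul0r.
right=> x x0.
have -> : (toC (diag_op (egf_coef (c *: linear_prod s)) p)).[x] =
    c%:C * (foldr (fun a r => r + (a%:C * x) *: r^`()) (toC p) s).[0].
  rewrite (@iter_deriv_at0 _ _ _ (size p)) ?size_map_poly //.
  rewrite (@horner_coef_wide _ (size p)) ?size_map_poly ?size_poly // mulr_sumr.
  apply: eq_bigr => k _; rewrite !coef_map coef_diag_op /egf_coef coefZ /=.
  rewrite !rmorphM /=; ring.
rewrite mulf_neq0 ?stable_iter //; first by rewrite (fmorph_eq0 (real_complex R)).
by rewrite horner_coef0 coef_map fmorph_eq0 -horner_coef0.
Qed.

(** One factor X at a time is perturbed into X + 1/(n+1), which lowers the
    multiplicity of the zero 0 while keeping all zeros real. *)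
Lemma diag_op_real_rootedMXn (c : R) s p m : all (>= 0) s ->
    no_nonreal_zeros p -> p.[0] != 0 ->
  no_nonreal_zeros (diag_op (egf_coef (c *: linear_prod s)) (p * 'X^m)).
Proof.
move=> s0; elim: m p => [|m IH] p Hp p0.
  by rewrite mulr1; exact: diag_op_real_rooted_nonroot0.
have pn0 : p != 0 by apply: contraNneq p0 => ->; rewrite horner0.
pose u n := p * ('X + (harmonic n)%:P) * 'X^m.
have su n : (size (u n) <= size p + m.+1)%N.
  have := size_polyMleq (p * ('X + (harmonic n)%:P)) 'X^m.
  have := size_polyMleq p ('X + (harmonic n)%:P).
  rewrite size_XaddC size_polyXn /u; lia.
apply: (@no_nonreal_zeros_cvg _ (size p + m.+1)
  (fun n => diag_op (egf_coef (c *: linear_prod s)) (u n))) => [n||n|k].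
- exact: leq_trans (size_poly _ _) (su n).
- apply: leq_trans (size_poly _ _) _.
  by have := size_polyMleq p 'X^(m.+1); rewrite size_polyXn; lia.
- apply: IH; last first.
    by rewrite hornerM hornerD hornerX hornerC add0r mulf_neq0 // gt_eqF // harmonic_gt0.
  case: Hp => [p00|Hp]; first by rewrite p00 eqxx in pn0.
  right=> z; rewrite rmorphM rootM => /orP[/Hp //|].
  rewrite rmorphD /= map_polyX map_polyC rootE hornerD hornerX hornerC.
  by case: z => a b /= /eqP[_]; rewrite addr0.
rewrite coef_diag_op; under eq_fun do rewrite coef_diag_op.
apply: cvgM; first exact: cvg_cst.
have -> : (fun n => (u n)`_k) =
    (fun n => (p * 'X^(m.+1))`_k + harmonic n * (p * 'X^m)`_k).
  apply/funext => n; rewrite /u mulrDr mulrDl -mulrA -exprS coefD; congr (_ + _).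
  by rewrite -mulrA mulrCA coefCM.
rewrite -[X in (_ --> X)%classic]addr0; apply: cvgD; first exact: cvg_cst.
rewrite -[X in (_ --> X)%classic](mul0r ((p * 'X^m)`_k)).
by apply: cvgM; [exact: cvg_harmonic|exact: cvg_cst].
Qed.

Lemma multiplier_sequence_linear_prod (c : R) s : all (>= 0) s ->
  multiplier_sequence (egf_coef (c *: linear_prod s)).
Proof.
move=> s0 p Hp; have [p0|pn0] := eqVneq p 0.
  by left; apply/polyP => k; rewrite coef_diag_op p0 coef0 mulr0.
have [m [q]] := multiplicity_XsubC p 0; rewrite pn0 subr0 => /= q0 Ep.
rewrite Ep; apply: diag_op_real_rootedMXn => //.
case: Hp => [p0|Hp]; first by rewrite p0 eqxx in pn0.
by right=> z Hz; apply: Hp; rewrite Ep rmorphM rootM Hz.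
Qed.

End PolynomialSymbol.

(** * Convergence of coefficients from pointwise convergence *)

Section Coefficients.
Variable R : realType.
Implicit Types (p q : {poly R}) (x M c : R).

Lemma horner_le_bounded p M x : (forall k, `|p`_k| <= M) -> 0 <= x <= 1 / 2 ->
  `|p.[x]| <= 2 * M.
Proof.
move=> + /andP[x0 x1]; elim/poly_ind: p => [|p c IH] HM.
  by have := HM 0%N; rewrite coef0 horner0 normr0; lra.
have Hc : `|c| <= M by have := HM 0%N; rewrite coefD coefMX coefC /= add0r.
have {IH} Hp : `|p.[x]| <= 2 * M.
  by apply: IH => k; have := HM k.+1; rewrite coefD coefMX coefC /= addr0.
rewrite hornerD hornerM hornerX hornerC.
apply: le_trans (ler_normD _ _) _; rewrite normrM (ger0_norm x0).
have := normr_ge0 p.[x]; nra.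
Qed.

Lemma horner_drop1 p x : p.[x] = p`_0 + x * (drop_poly 1 p).[x].
Proof.
rewrite -{1}(poly_take_drop 1 p) hornerD hornerM hornerXn expr1 mulrC.
congr (_ + _); rewrite (@horner_coef_wide _ 1) ?size_take_poly //.
by rewrite big_ord1 mulr1 coef_take_poly.
Qed.

(** The constant coefficient of u_n differs from u_n(x) by at most 2 M x, where x
    is as small as desired; then u_n - u_n(0) is divided by X to reach the next
    coefficient. *)
Lemma coef_cvg0 (u : nat -> {poly R}) M k :
    (forall n i, `|(u n)`_i| <= M) ->
    (forall x, 0 < x <= 1 / 2 -> ((u n).[x] @[n --> \oo] --> 0)%classic) ->
  ((u n)`_k @[n --> \oo] --> 0)%classic.
Proof.
have base (v : nat -> {poly R}) : (forall n i, `|(v n)`_i| <= M) ->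
    (forall x, 0 < x <= 1 / 2 -> ((v n).[x] @[n --> \oo] --> 0)%classic) ->
    ((v n)`_0 @[n --> \oo] --> 0)%classic.
  move=> HM Hv; have M0 : 0 <= M := le_trans (normr_ge0 _) (HM 0%N 0%N).
  apply/cvgr0Pnorm_lt => e e0.
  pose x := Num.min (1 / 2) (e / (4 * (M + 1))).
  have x0 : 0 < x by rewrite lt_min !divr_gt0 // mulr_gt0 // ltr_wpDl.
  have x1 : x <= 1 / 2 by rewrite ge_min lexx.
  have xM : x * (2 * M) <= e / 2.
    have : x <= e / (4 * (M + 1)) by rewrite ge_min lexx orbT.
    rewrite ler_pdivlMr ?mulr_gt0 ?ltr_wpDl // => H.
    have := mulr_ge0 (ltW x0) M0; nra.
  have := Hv x; rewrite x0 x1 => /(_ isT) /cvgr0Pnorm_lt /(_ (e / 2)).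
  rewrite divr_gt0 // => /(_ isT) H; near=> n.
  have -> : (v n)`_0 = (v n).[x] - x * (drop_poly 1 (v n)).[x].
    by rewrite horner_drop1 addrK.
  apply: le_lt_trans (ler_normB _ _) _.
  rewrite (splitr e); apply: ltr_leD; first by near: n.
  apply: le_trans xM; rewrite normrM gtr0_norm // ler_pM2l //.
  by apply: horner_le_bounded => [i|]; rewrite ?coef_drop_poly ?(ltW x0).
elim: k u => [|k IH] u HM Hu; first exact: base.
have H0 := base _ HM Hu.
have -> : (fun n => (u n)`_k.+1) = (fun n => (drop_poly 1 (u n))`_k).
  by apply/funext => n; rewrite coef_drop_poly addn1.
apply: IH => [n i|x /[dup] Hx /andP[x0 _]]; first by rewrite coef_drop_poly.
have -> : (fun n => (drop_poly 1 (u n)).[x]) =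
    (fun n => ((u n).[x] - (u n)`_0) * x^-1).
  apply/funext => n; rewrite (horner_drop1 (u n)) [X in X - _]addrC addrK mulrAC divff ?mul1r //.
  by rewrite gt_eqF.
rewrite -[X in (_ --> X)%classic](mul0r x^-1); apply: cvgM; last exact: cvg_cst.
by rewrite -[X in (_ --> X)%classic](subr0 0); apply: cvgB => //; exact: Hu.
Unshelve. all: by end_near.
Qed.

Lemma coef_le_horner1 p k : (forall i, 0 <= p`_i) -> p`_k <= p.[1].
Proof.
move=> p0; rewrite horner_coef; under eq_bigr do rewrite expr1n mulr1.
have [kp|pk] := ltnP k (size p).
  rewrite (bigD1 (Ordinal kp)) //= lerDl sumr_ge0 //.
by rewrite nth_default // sumr_ge0.
Qed.

(** Nonnegativity bounds all coefficients of K_n by K_n(1), uniformly in n, and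
    this turns pointwise convergence into convergence of coefficients: the
    differences of c K_n and the partial sums of the series fall under
    [coef_cvg0]. *)
Lemma coef_cvg (c : R) (K : nat -> {poly R}) (g : nat -> R) (f : R -> R) k :
    (forall n i, 0 <= (K n)`_i) ->
    (forall x, 0 < x -> (c * (K n).[x] @[n --> \oo] --> f x)%classic) ->
    (forall x, 0 < x ->
      ((fun n => \sum_(i < n) g i * x ^+ i) @ \oo --> f x)%classic) ->
  (c * (K n)`_k @[n --> \oo] --> g k)%classic.
Proof.
move=> K0 HK Hg.
have [M1 M10 H1] : exists2 M, 0 < M & forall n, `|c * (K n).[1]| <= M.
  have /cvg_seq_bounded/pinfty_ex_gt0[M M0 /= HM] : cvgn (fun n => c * (K n).[1]).
    by apply/cvg_ex; exists (f 1); apply: HK.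
  by exists M => // n; apply: HM.
have [M2 M20 H2] : exists2 M, 0 < M & forall n, `|g n| <= M.
  have /cvg_series_bounded/pinfty_ex_gt0[M M0 /= HM] : cvgn (series g).
    have -> : series g = (fun n => \sum_(i < n) g i * 1 ^+ i).
      apply/funext => n; rewrite /series /= big_mkord.
      by apply: eq_bigr => i _; rewrite expr1n mulr1.
    by apply/cvg_ex; exists (f 1); exact: Hg.
  by exists M => // n; apply: HM.
pose u n := c *: K n - \poly_(i < n) g i.
have : ((u n)`_k @[n --> \oo] --> 0)%classic.
  apply: (@coef_cvg0 _ (M1 + M2)) => [n i|x /andP[x0 _]].
    rewrite coefB coefZ coef_poly; apply: le_trans (ler_normB _ _) _.
    apply: lerD; last by case: ifP; rewrite ?normr0 ?(ltW M20).
    apply: le_trans (H1 n); rewrite !normrM ler_wpM2l //.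
    by apply: le_trans (ler_norm _); rewrite ger0_norm ?coef_le_horner1.
  have -> : (fun n => (u n).[x]) =
      (fun n => c * (K n).[x] - \sum_(i < n) g i * x ^+ i).
    by apply/funext => n; rewrite hornerD hornerN hornerZ horner_poly.
  by rewrite -[X in (_ --> X)%classic](subrr (f x)); apply: cvgB; auto.
move=> Hu; rewrite -[X in (_ --> X)%classic]add0r.
have -> : (fun n => c * (K n)`_k) = (fun n => (u n)`_k + (if (k < n)%N then g k else 0)).
  by apply/funext => n; rewrite coefB coefZ coef_poly subrK.
apply: cvgD => //; apply: cvg_near_cst; near=> n; rewrite ifT //.
by near: n; exact: nbhs_infty_gt.
Unshelve. all: by end_near.
Qed.

(** With v = y / N, the bounds exp(v - v^2) <= 1 + v <= exp(v) are raised to the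
    power N. *)
Lemma expR_cvg (y : R) : 0 <= y ->
  ((1 + y * harmonic n) ^+ n.+1 @[n --> \oo] --> expR y)%classic.
Proof.
move=> y0.
apply: (@squeeze_cvgr _ _ _ _ (fun n => expR (y - y ^+ 2 * harmonic n)) (fun=> expR y)).
- apply: nearW => n; have h0 : 0 <= y * harmonic n by rewrite mulr_ge0 // harmonic_ge0.
  have hn : n.+1%:R * harmonic n = 1 :> R by rewrite /harmonic /= divff.
  apply/andP; split; last first.
    have -> : expR y = expR (y * harmonic n) ^+ n.+1.
      by rewrite -expRM_natl mulrCA hn mulr1.
    by rewrite lerXn2r ?nnegrE ?expR_ge0 ?expR_ge1Dx // addr_ge0.
  set v := y * harmonic n; have Nv : n.+1%:R * v = y by rewrite /v mulrCA hn mulr1.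
  have -> : y - y ^+ 2 * harmonic n = n.+1%:R * (v - v ^+ 2).
    by rewrite mulrBr [v ^+ 2]expr2 (mulrA _ v) Nv /v; ring.
  rewrite expRM_natl lerXn2r ?nnegrE ?expR_ge0 ?addr_ge0 //.
  have := expR_ge1Dx (- (v - v ^+ 2)); have := expRxMexpNx_1 (v - v ^+ 2).
  have := expR_gt0 (v - v ^+ 2); set E := expR _; set E' := expR _ => E0 EE H.
  have v3 : 0 <= v ^+ 3 by rewrite exprn_ge0.
  have : E * (1 - v + v ^+ 2) <= 1 by rewrite -EE ler_wpM2l ?(ltW E0) //; move: H; lra.
  (* exp(v - v^2) <= 1 / (1 - v + v^2), and (1 + v) (1 - v + v^2) = 1 + v^3 >= 1. *)
  move=> H2; rewrite -subr_ge0.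
  have -> : 1 + v - E = (1 + v) * (1 - E * (1 - v + v ^+ 2)) + E * v ^+ 3 by ring.
  apply: addr_ge0; apply: mulr_ge0 => //; last exact: ltW.
    exact: addr_ge0.
  by rewrite subr_ge0.
- apply: continuous_cvg; first exact: continuous_expR.
  rewrite -[X in (_ --> X)%classic]subr0; apply: cvgB; first exact: cvg_cst.
  rewrite -[X in (_ --> X)%classic](mulr0 (y ^+ 2)).
  by apply: cvgM; [exact: cvg_cst|exact: cvg_harmonic].
- exact: cvg_cst.
Qed.

End Coefficients.

(** * Type I functions as limits of products of linear factors *)

Section LaguerrePolya.
Variable R : realType.
Implicit Types (s : seq R) (a c t y : R).
Local Notation Re := complex.Re.
Local Notation Im := complex.Im.

Lemma linear_prod_cat s1 s2 :
  linear_prod (s1 ++ s2) = linear_prod s1 * linear_prod s2.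
Proof. exact: big_cat. Qed.

Lemma linear_prod_nseq n a : linear_prod (nseq n a) = (1 + a *: 'X) ^+ n.
Proof. by rewrite /linear_prod big_nseq -Monoid.iteropE. Qed.

Lemma linear_prod_ge0 s k : all (>= 0) s -> 0 <= (linear_prod s)`_k.
Proof.
elim: s k => [|a s IH] k; first by rewrite /linear_prod big_nil coef1 ler0n.
move=> /= /andP[a0 /IH s0]; rewrite /linear_prod big_cons mulrC coef_mul_linear.
by rewrite addr_ge0 ?mulr_ge0 //; case: ifP.
Qed.

Lemma coef_linear_prod_scale t s k :
  (linear_prod [seq t * a | a <- s])`_k = t ^+ k * (linear_prod s)`_k.
Proof.
elim: s k => [|a s IH] k.
  rewrite /= /linear_prod big_nil coef1.
  by case: k => [|k]; rewrite ?mulr1 ?mulr0.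
rewrite /linear_prod /= !big_cons -!/(linear_prod _).
rewrite ![(1 + _) * _]mulrC !coef_mul_linear.
case: k => [|k] /=; first by rewrite !IH !mulr0 !addr0.
by rewrite !IH exprS; ring.
Qed.

Lemma horner_linear a y : (1 + a *: 'X).[y] = 1 + a * y.
Proof. by rewrite hornerD -polyC1 hornerC hornerZ hornerX. Qed.

(** The power series in the closure, for coefficientwise convergence, of the
    polynomials to which [multiplier_sequence_linear_prod] applies. *)
Definition lp_limit (g : nat -> R) : Prop :=
  exists (c : nat -> R) (s : nat -> seq R),
    (forall n, all (>= 0) (s n)) /\
    forall k, ((c n *: linear_prod (s n))`_k @[n --> \oo] --> g k)%classic.

Lemma exp_coef_cvg a k : 0 <= a ->
  ((linear_prod (nseq n.+1 (a * harmonic n)))`_k @[n --> \oo] --> a ^+ k / k`!%:R)%classic.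
Proof.
move=> a0.
under eq_fun do rewrite -[(linear_prod _)`_k]mul1r.
apply: (@coef_cvg _ 1 (fun n => linear_prod (nseq n.+1 (a * harmonic n)))
  (fun k => a ^+ k / k`!%:R) (fun y => expR (a * y))) => [n i|y y0|y y0].
- by apply: linear_prod_ge0; rewrite all_nseq mulr_ge0 ?harmonic_ge0 ?orbT.
- have := @expR_cvg R (a * y); rewrite mulr_ge0 ?(ltW y0) // => /(_ isT).
  have -> : (fun n => 1 * (linear_prod (nseq n.+1 (a * harmonic n))).[y]) =
      (fun n => (1 + a * y * harmonic n) ^+ n.+1) => //.
  apply/funext => n.
  by rewrite mul1r linear_prod_nseq horner_exp horner_linear mulrAC.
- rewrite /expR.
  have -> : (fun n => \sum_(i < n) a ^+ i / i`!%:R * y ^+ i) = series (exp_coeff (a * y)).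
    apply/funext => n; rewrite /series /= big_mkord; apply: eq_bigr => i _.
    by rewrite /exp_coeff /= exprMn mulrAC.
  exact: is_cvg_series_exp_coeff.
Qed.

(** The approximants of exp((1 - t) x) g(t x), for g the limit of the given
    products, are obtained by scaling the factors by t and appending n + 1 factors
    1 + (1 - t) x / (n + 1). *)
Lemma multiplier_bernstein (gamma : nat -> R) t : 0 <= t <= 1 ->
  lp_limit (fun k => gamma k / k`!%:R) ->
  multiplier_sequence (bernstein_seq gamma t).
Proof.
move=> /andP[t0 t1] [c [s [s0 cs]]].
pose S n := nseq n.+1 ((1 - t) * harmonic n) ++ [seq t * a | a <- s n].
apply: (@multiplier_sequence_cvg _ (fun n => egf_coef (c n *: linear_prod (S n)))) => [n|k].
  apply: multiplier_sequence_linear_prod; rewrite all_cat all_nseq.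
  rewrite mulr_ge0 ?subr_ge0 ?harmonic_ge0 ?orbT //= all_map.
  by apply/allP => a /(allP (s0 n)) /= a0; rewrite mulr_ge0.
have -> : bernstein_seq gamma t k = k`!%:R * \sum_(j < k.+1)
    ((1 - t) ^+ j / j`!%:R) * (t ^+ (k - j) * (gamma (k - j)%N / (k - j)`!%:R)).
  rewrite /bernstein_seq mulr_sumr; apply: eq_bigr => j _.
  have jk : (j <= k)%N by rewrite -ltnS.
  rewrite -(bin_fact jk) !natrM; field.
  by rewrite !pnatr_eq0 -!lt0n !fact_gt0.
rewrite /egf_coef; apply: cvgM; first exact: cvg_cst.
have -> : (fun n => (c n *: linear_prod (S n))`_k) = (fun n => \sum_(j < k.+1)
    (linear_prod (nseq n.+1 ((1 - t) * harmonic n)))`_j *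
    (t ^+ (k - j) * (c n *: linear_prod (s n))`_(k - j))).
  apply/funext => n; rewrite /S linear_prod_cat scalerAr coefM.
  apply: eq_bigr => j _; congr (_ * _).
  by rewrite !coefZ coef_linear_prod_scale mulrCA.
apply: cvg_sum_seq => j _; apply: cvgM.
  by apply: exp_coef_cvg; rewrite subr_ge0.
by apply: cvgM; [exact: cvg_cst|exact: cs].
Qed.

Lemma seq_cvg_dist (K : numFieldType) (u : nat -> K) (l : K) : seq_cvg u l ->
  forall e, 0 < e -> \forall n \near \oo%classic, `|l - u n| < e.
Proof. by move=> /cvgrPdist_lt. Qed.

Lemma seq_cvg_Re (u : nat -> R[i]) l : seq_cvg u l ->
  (Re (u n) @[n --> \oo] --> Re l)%classic.
Proof.
move=> /seq_cvg_dist ul; apply/cvgrPdist_lt => e e0.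
have := ul e%:C; rewrite ltcR => /(_ e0); apply: filterS => n.
rewrite -ltcR; apply: le_lt_trans.
have -> : Re l - Re (u n) = Re (l - u n).
  by case: (l) (u n) => [a b] [c d].
exact: normc_ge_Re.
Qed.

Lemma real_entire_Re (gamma : nat -> R) phi y : real_entire gamma phi ->
  ((fun n => \sum_(i < n) gamma i / i`!%:R * y ^+ i) @ \oo --> Re (phi y%:C))%classic.
Proof.
move=> /(_ y%:C) /seq_cvg_Re.
have -> : (fun n => \sum_(i < n) gamma i / i`!%:R * y ^+ i) = (fun n =>
   Re (\sum_(k < n) (gamma k / (k`!)%:R)%:C * y%:C ^+ k)).
  apply/funext => n; rewrite Re_sum; apply: eq_bigr => i _.
  by rewrite -rmorphXn -rmorphM.
by [].
Qed.

Definition type_I_data (phi : R[i] -> R[i]) c m (sigma : R) omega (x : nat -> R) :=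
  forall z : R[i],
    exists2 P : R[i],
      seq_cvg (fun n => \prod_(k < n | below omega k) (1 + z / (x k)%:C)) P
      & phi z = c%:C * z ^+ m * cexp (sigma%:C * z) * P.

Lemma product_Re phi c m sigma omega x y : type_I_data phi c m sigma omega x ->
  exists2 P : R,
    (\prod_(k < n | below omega k) (1 + y / x k) @[n --> \oo] --> P)%classic
    & Re (phi y%:C) = c * y ^+ m * expR (sigma * y) * P.
Proof.
move=> /(_ y%:C) [P /seq_cvg_Re HP ->]; exists (Re P).
  have -> : (fun n => \prod_(k < n | below omega k) (1 + y / x k)) = (fun n =>
     Re (\prod_(k < n | below omega k) (1 + y%:C / (x k)%:C))).
    apply/funext => n.
    under [in RHS]eq_bigr do rewrite -fmorphV -rmorphM -(rmorph1 (real_complex R)) -rmorphD.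
    by rewrite -rmorph_prod.
  by [].
rewrite -rmorphM -rmorphXn -rmorphM /cexp /= cos0 sin0.
case: P {HP} => p1 p2 /=.
ring.
Qed.

Lemma horner_linear_prod s y : (linear_prod s).[y] = \prod_(a <- s) (1 + a * y).
Proof. by rewrite horner_prod; apply: eq_bigr => a _; rewrite horner_linear. Qed.

(** The zero at the origin is approached by the factor (x + h)^m, which is
    h^m (1 + x / h)^m with h = 1 / (n + 1); this explains the m factors of slope
    1 / h and the constant c h^m. *)
Lemma type_I_lp_limit (gamma : nat -> R) phi :
    real_entire gamma phi -> has_type_I_product phi ->
  lp_limit (fun k => gamma k / k`!%:R).
Proof.
move=> hphi [c [m [sigma [omega [x [sigma0 x0 _ hprod]]]]]].
pose s n := nseq m (harmonic n : R)^-1 ++ nseq n.+1 (sigma * harmonic n) ++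
  [seq (x k)^-1 | k <- iota 0 n & below omega k].
have s0 n : all (>= 0) (s n).
  rewrite !all_cat !all_nseq invr_ge0 harmonic_ge0 mulr_ge0 ?harmonic_ge0 //.
  rewrite !orbT all_map all_filter; apply/allP => k _ /=; apply/implyP => wk.
  by rewrite invr_ge0 ltW ?x0.
exists (fun n => c * harmonic n ^+ m), s; split=> // k.
under eq_fun do rewrite -scalerA coefZ.
apply: (@coef_cvg _ c (fun n => harmonic n ^+ m *: linear_prod (s n))
  (fun i => gamma i / i`!%:R)
  (fun y => Re (phi y%:C))) => [n i|y y0|y y0].
- by rewrite coefZ mulr_ge0 ?exprn_ge0 ?harmonic_ge0 // linear_prod_ge0.
- have [P hP ->] := product_Re y hprod.
  have -> : (fun n => c * (harmonic n ^+ m *: linear_prod (s n)).[y]) =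
    (fun n => c * (harmonic n + y) ^+ m * (1 + sigma * y * harmonic n) ^+ n.+1 *
       \prod_(k < n | below omega k) (1 + y / x k)).
    apply/funext => n; rewrite hornerZ /s !linear_prod_cat !hornerM.
    rewrite !linear_prod_nseq !horner_exp !horner_linear !mulrA.
    congr (_ * _ * _).
    + rewrite -!mulrA -exprMn mulrDr mulr1 mulrA divff ?mul1r //.
      by rewrite gt_eqF // harmonic_gt0.
    + by rewrite mulrAC.
    + rewrite horner_linear_prod big_map big_filter.
      have -> : iota 0 n = index_iota 0 n by rewrite /index_iota subn0.
      by rewrite big_mkord; apply: eq_bigr => j _; rewrite mulrC.
  apply: cvgM => //; apply: cvgM; last by apply: expR_cvg; rewrite mulr_ge0 // ltW.
  apply: cvgM; first exact: cvg_cst.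
  apply: cvg_exprn; rewrite -[X in (_ --> X)%classic]add0r.
  by apply: cvgD; [exact: cvg_harmonic|exact: cvg_cst].
- exact: real_entire_Re.
Qed.

Lemma limit_unique (u : nat -> R) (l l' : R) :
  (u n @[n --> \oo] --> l)%classic -> (u n @[n --> \oo] --> l')%classic -> l = l'.
Proof. exact/cvg_unique/norm_hausdorff. Qed.

(** Nonnegative coefficients give |phi(-y)| <= phi(y) for y >= 0.  Unless c = 0, a
    factor 1 + z / x_k would make phi vanish at x_k but not at -x_k, and sigma > 0
    would then make |phi(-1)| larger than phi(1).  What remains is
    phi(-z) = c z^m, that is phi(z) = c (-1)^m z^m. *)
Lemma type_I_reflect (gamma : nat -> R) phi :
    real_entire gamma phi -> (forall k, 0 <= gamma k) ->
    has_type_I_product (fun z => phi (- z)) ->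
  has_type_I_product phi.
Proof.
move=> hphi g0 [c [m [sigma [omega [x [sigma0 x0 xs hprod]]]]]].
have dom y : 0 <= y -> `|Re (phi (- y%:C))| <= Re (phi y%:C).
  move=> y0; rewrite -rmorphN.
  apply: (ler_cvg_to (cvg_norm (real_entire_Re (y := - y) hphi)) (real_entire_Re (y := y) hphi)).
  apply: nearW => n; apply: le_trans (ler_norm_sum _ _ _) _.
  apply: ler_sum => i _; rewrite normrM normrX normrN (ger0_norm y0) ger0_norm //.
  by rewrite divr_ge0.
have [c0|cn0] := eqVneq c 0.
  exists c, m, sigma, omega, x; split=> // z.
  have [P hP _] := hprod z; exists P => //.
  by have [Q _] := hprod (- z); rewrite opprK c0 rmorph0 !mul0r.
have no_factor k : below omega k = false.
  apply/negP => wk; have xk := x0 k wk.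
  have phi0 : Re (phi (x k)%:C) = 0.
    have [P hP] := product_Re (- x k) hprod; rewrite rmorphN opprK => ->.
    suff -> : P = 0 by rewrite mulr0.
    apply: (limit_unique hP); apply: cvg_near_cst; near=> n.
    have kn : (k < n)%N by near: n; exact: nbhs_infty_gt.
    rewrite (bigD1 (Ordinal kn)) //= mulNr divff ?gt_eqF // subrr mul0r //.
  have := dom _ (ltW xk); rewrite phi0 normr_le0.
  have [P hP ->] := product_Re (x k) hprod.
  have P1 : 1 <= P.
    apply: (cvgr_to_ge hP); apply: nearW => n.
    elim/big_ind: _ => // [a b a1 b1|j wj]; first exact: mulr_ege1.
    by rewrite lerDl divr_ge0 ?(ltW xk) // ltW // x0.
  by rewrite !mulf_eq0 (negbTE cn0) expf_eq0 !gt_eqF ?expR_gt0 ?andbF //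
    (lt_le_trans ltr01).
have prod1 (K : numFieldType) n (F : 'I_n -> K) :
    \prod_(k < n | below omega k) F k = 1.
  by rewrite big_pred0 // => k; rewrite no_factor.
have sigma00 : sigma = 0.
  apply/eqP; rewrite eq_le sigma0 andbT.
  have [P hP E1] := product_Re 1 hprod.
  have [Q hQ E2] := product_Re (- 1) hprod.
  have P1 : P = 1.
    by apply: (limit_unique hP); apply: cvg_near_cst; apply: nearW => n; exact: prod1.
  have Q1 : Q = 1.
    by apply: (limit_unique hQ); apply: cvg_near_cst; apply: nearW => n; exact: prod1.
  have := dom 1 ler01; rewrite E1 -[X in Re (phi X)]opprK -rmorphN E2 P1 Q1.
  rewrite !mulr1 expr1n mulr1 => /le_trans /(_ (ler_norm _)).
  rewrite !normrM normrX normrN normr1 expr1n mulr1 ler_pM2l ?normr_gt0 //.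
  rewrite !ger0_norm ?expR_ge0 // ler_expR; lra.
exists (c * (-1) ^+ m), m, sigma, omega, x; split=> // z.
have [P hP E] := hprod (- z); exists P.
  suff -> : (fun n => \prod_(k < n | below omega k) (1 + z / (x k)%:C)) =
    (fun n => \prod_(k < n | below omega k) (1 + - z / (x k)%:C)) by [].
  by apply/funext => n; rewrite !prod1.
move: E; rewrite opprK sigma00 rmorph0 !mul0r => ->.
by rewrite [in LHS]exprNn rmorphM rmorphXn rmorphN rmorph1 !mulrA.
Unshelve. all: by end_near.
Qed.

End LaguerrePolya.

Unset Implicit Arguments.
Set Strict Implicit.
Set Printing Implicit Defensive.

Theorem proposition28 (R : realType) (gamma : nat -> R) (phi : R[i] -> R[i])
    (hphi : laguerre_polya_plus gamma phi) (t : R) (ht : 0 <= t <= 1) :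
  multiplier_sequence (bernstein_seq gamma t).
Proof.
have [[entire product] gamma0] := hphi.
apply: multiplier_bernstein => //; apply: (type_I_lp_limit entire).
by case: product => //; exact: type_I_reflect entire gamma0.
Qed.
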